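(* Let $q$ be a power of an odd prime and let $\mathcal{K}\subset\mathbb{F}_q$. Then: (i) $\mathcal{K}$ is a radius circular Kakeya set in $\mathbb{F}_q$ if and only if $\mathcal{K}-\mathcal{K}=\mathbb{F}_q$; (ii) $\mathcal{K}$ is a center circular Kakeya set in $\mathbb{F}_q$ if and only if $\mathcal{K}\oplus\mathcal{K}=\mathbb{F}_q$.
   Context: $\mathbb{F}_q$ is the finite field with $q$ elements and $\mathbb{F}_q^*=\mathbb{F}_q\setminus\{0\}$. The circle in $\mathbb{F}_q$ with radius $r\in\mathbb{F}_q^*$ and center $a\in\mathbb{F}_q$ is $\{x\in\mathbb{F}_q : (x-a)^2=r^2\}=\{a+r,a-r\}$. A radius circular Kakeya set in $\mathbb{F}_q$ is a subset of $\mathbb{F}_q$ such that for each $r\in\mathbb{F}_q^*$ it contains a circle of radius $r$ (with some center $a\in\mathbb{F}_q$). A center circular Kakeya set in $\mathbb{F}_q$ is a subset of $\mathbb{F}_q$ such that for each $a\in\mathbb{F}_q$ it contains a circle with center $a$ (of some radius $r\in\mathbb{F}_q^*$). Notation: $\mathcal{K}-\mathcal{K}=\{x_1-x_2 : x_1,x_2\in\mathcal{K}\}$ and $\mathcal{K}\oplus\mathcal{K}=\{x_1+x_2 : x_1,x_2\in\mathcal{K},\ x_1\ne x_2\}$. *)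

(* Defs.v *)
From mathcomp Require Import all_boot all_algebra.

Set Implicit Arguments.
Unset Strict Implicit.
Unset Printing Implicit Defensive.

Import GRing.Theory.
Local Open Scope ring_scope.

Definition circle (F : finFieldType) (a r : F) : {set F} :=
  [set x | (x - a) ^+ 2 == r ^+ 2].

Lemma circleE (F : finFieldType) (a r : F) :
  circle a r = [set a + r; a - r].
Proof.
apply/setP=> x; rewrite !inE eqf_sqr.
by rewrite !subr_eq ![_ + a]addrC.
Qed.

Definition radius_circular_Kakeya (F : finFieldType) (K : {set F}) : Prop :=
  forall r : F, r != 0 -> exists a : F, circle a r \subset K.

Definition center_circular_Kakeya (F : finFieldType) (K : {set F}) : Prop :=
  forall a : F, exists r : F, r != 0 /\ circle a r \subset K.

Definition diffset (F : finFieldType) (K : {set F}) : {set F} :=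
  [set x1 - x2 | x1 in K, x2 in K].

Definition restricted_sumset (F : finFieldType) (K : {set F}) : {set F} :=
  [set x1 + x2 | x1 in K, x2 in K & x1 != x2].

(* Main.v *)
Require Import Defs.
From mathcomp Require Import all_boot all_algebra.
From mathcomp Require Import finfield ring.

Local Open Scope ring_scope.

Import GRing.Theory.

(** The two points [a + r] and [a - r] of a circle have difference [2r] and sum [2a], and conversely
    two points with difference [2r] or sum [2a] form a circle of radius [r] or center [a]. In odd
    characteristic doubling is a bijection of the field, so radii correspond to differences and
    centers to sums. A radius is nonzero exactly when the two points are distinct, whence the
    restricted sumset. *)

Lemma circle_subset (F : finFieldType) (K : {set F}) (a r : F) :
  (circle a r \subset K) = (a + r \in K) && (a - r \in K).
Proof. by rewrite circleE subUset !sub1set. Qed.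

(** The characteristic is [p], so [2 = 0] would make [p] divide 2, forcing [p = 2]. *)
Lemma odd_card_two_neq0 (F : finFieldType) (p k : nat) :
  prime p -> odd p -> #|F| = (p ^ k)%N -> 2%:R != 0 :> F.
Proof.
move=> p_prime p_odd cardF.
rewrite -(dvdn_pcharf (card_finPcharP cardF p_prime)) dvdn_prime2 //.
by apply: contraL p_odd => /eqP->.
Qed.

Lemma radius_Kakeya_diffset (F : finFieldType) (K : {set F}) :
  2%:R != 0 :> F -> radius_circular_Kakeya K <-> diffset K = [set: F].
Proof.
move=> nz2; split=> [KK | KF r _].
  apply/setP=> d; rewrite inE; apply/imset2P.
  have [->|nzd] := eqVneq d 0.
    (* Difference 0 only needs a point of [K]; a circle of radius 1 supplies one. *)
    have [a] := KK 1 (oner_neq0 F).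
    rewrite circle_subset => /andP[Kx _].
    by exists (a + 1) (a + 1); rewrite ?subrr.
  have [a] := KK (d / 2%:R) (mulf_neq0 nzd (invr_neq0 nz2)).
  rewrite circle_subset => /andP[Kx Ky].
  by exists (a + d / 2%:R) (a - d / 2%:R) => //; field.
have /imset2P[x y Kx Ky Er] : r *+ 2 \in diffset K by rewrite KF inE.
(* As [x - y = 2r], the center is the midpoint [x - r = y + r]. *)
exists (x - r); rewrite circle_subset subrK Kx /=.
by rewrite -addrA -opprD -mulr2n Er subKr.
Qed.

Lemma center_Kakeya_restricted_sumset (F : finFieldType) (K : {set F}) :
  2%:R != 0 :> F ->
  center_circular_Kakeya K <-> restricted_sumset K = [set: F].
Proof.
move=> nz2; split=> [KK | KF a].
  apply/setP=> s; rewrite inE; apply/imset2P.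
  have [r [nzr]] := KK (s / 2%:R); rewrite circle_subset => /andP[Kx Ky].
  exists (s / 2%:R + r) (s / 2%:R - r); rewrite ?inE ?Ky //=; last by field.
  (* The summands are distinct since they differ by [2r], which is nonzero. *)
  rewrite -subr_eq0 (_ : _ - _ = 2%:R * r); last by ring.
  exact: mulf_neq0.
have /imset2P[x y Kx] : a *+ 2 \in restricted_sumset K by rewrite KF inE.
rewrite inE => /andP[Ky neq_xy] Ea.
(* From [x + y = 2a], [y] is the reflection of [x] in [a], so [x - a] serves as radius; were it 0,
   [x] and [y] would coincide. *)
have Ey : y = a - (x - a) by rewrite opprB addrA -mulr2n Ea addrAC subrr add0r.
exists (x - a); rewrite circle_subset (addrC a) subrK Kx -Ey Ky; split=> //.
by apply: contraNneq neq_xy => xa; rewrite Ey xa subr0 -subr_eq0 xa.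
Qed.

Theorem mainTheorem6 (p k q : nat) (p_prime : prime p) (p_odd : odd p)
    (k_gt0 : (0 < k)%N) (qE : q = (p ^ k)%N)
    (F : finFieldType) (cardF : #|F| = q) (K : {set F}) :
  (radius_circular_Kakeya K <-> diffset K = [set: F]) /\
  (center_circular_Kakeya K <-> restricted_sumset K = [set: F]).
Proof.
have nz2 : 2%:R != 0 :> F.
  by apply: odd_card_two_neq0 p_prime p_odd _; rewrite cardF; apply: qE.
split; first exact: radius_Kakeya_diffset.
exact: center_Kakeya_restricted_sumset.
Qed.
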